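(* Let $\alpha>0$. The empirical fractional generalized cumulative entropy of an absolutely continuous nonnegative random variable $X$ is stable provided that $X$ has a distribution on a finite interval.
   Context: Let $X_1,\dots,X_n$ be a random sample from the distribution of $X$, with order statistics $X_{1:n}\le\cdots\le X_{n:n}$ and empirical distribution function $\hat F_n(x)=\frac1n\sum_{i=1}^n I_{\{X_i\le x\}}$. The empirical fractional generalized cumulative entropy of order $\alpha>0$ is $$CE_{\alpha}(\hat F_n)=\frac{1}{\Gamma(\alpha+1)}\sum_{k=1}^{n-1}(X_{k+1:n}-X_{k:n})\,\frac{k}{n}\left[-\ln\frac{k}{n}\right]^{\alpha}.$$ Stability: let $X_1',\dots,X_n'$ be any small deformation of the sample $X_1,\dots,X_n$, with corresponding empirical distribution function $\hat F_n'$ and entropy $CE_\alpha(\hat F_n')$ (same formula applied to the ordered values of $X_1',\dots,X_n'$). The empirical fractional generalized cumulative entropy is called stable if for all $\epsilon>0$ there exists $\delta>0$ such that, for all $n\in\mathbb N$, $$\sum_{k=1}^{n}|X_k-X_k'|<\delta\ \Rightarrow\ \left|CE_{\alpha}(\hat F_n)-CE_{\alpha}(\hat F_n')\right|<\epsilon.$$ *)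

(* Defs.v *)
From HB Require Import structures.
From mathcomp Require Export all_boot all_order all_algebra.
From mathcomp Require Export all_classical all_reals all_analysis.
Import Order.TTheory GRing.Theory Num.Theory.
Import numFieldNormedType.Exports.

Set Implicit Arguments.
Unset Strict Implicit.
Unset Printing Implicit Defensive.

Local Open Scope classical_set_scope.
Local Open Scope ring_scope.

(* Euler's integral; only meaningful for 0 < s, where the integral is finite. *)
Definition Gamma (R : realType) (s : R) : R :=
  fine (\int[@lebesgue_measure R]_(t in `]0%R, +oo[)
          (t `^ (s - 1) * expR (- t))%:E)%E.

(* x_{k:n}, for 1 <= k <= n: [nth] counts from 0, order statistics from 1. *)
Definition order_stat (R : realType) (n : nat) (x : 'I_n -> R) (k : nat) : R :=
  nth 0 (sort <=%R [seq x i | i : 'I_n]) k.-1.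

Definition empirical_CE (R : realType) (alpha : R) (n : nat) (x : 'I_n -> R) : R :=
  (Gamma (alpha + 1))^-1 *
  \sum_(1 <= k < n)
     (order_stat x k.+1 - order_stat x k) *
     (k%:R / n%:R) * (- ln (k%:R / n%:R)) `^ alpha.

Definition mutually_independent (R : realType) (d : measure_display)
    (Omega : measurableType d) (Q : probability Omega R) (n : nat)
    (Y : 'I_n -> {RV Q >-> R}) : Prop :=
  forall (J : {set 'I_n}) (A : 'I_n -> set R), (forall i, measurable (A i)) ->
    Q (\bigcap_(i in [set i | i \in J]) (Y i @^-1` A i)) =
    (\prod_(i in J) Q (Y i @^-1` A i))%E.

(* The sample may live on a probability space other than that of X: only the
   distribution of X matters. *)
Definition random_sample (R : realType)
    (d : measure_display) (T : measurableType d) (P : probability T R)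
    (X : {RV P >-> R})
    (d' : measure_display) (Omega : measurableType d') (Q : probability Omega R)
    (n : nat) (Y : 'I_n -> {RV Q >-> R}) : Prop :=
  mutually_independent Y /\
  forall (i : 'I_n) (A : set R), measurable A ->
    distribution Q (Y i) A = distribution P X A.

(* The implication is read realization by realization, with delta independent
   of the realization; the deformation Y' is an arbitrary perturbation, not
   required to be measurable or to have any particular distribution. *)
Definition empirical_CE_stable (R : realType) (alpha : R)
    (d : measure_display) (T : measurableType d) (P : probability T R)
    (X : {RV P >-> R}) : Prop :=
  forall eps : R, 0 < eps -> exists2 delta : R, 0 < delta &
    forall (n : nat) (d' : measure_display) (Omega : measurableType d')
      (Q : probability Omega R) (Y : 'I_n -> {RV Q >-> R}),
      random_sample X Y ->
      forall (Y' : 'I_n -> Omega -> R) (w : Omega),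
        \sum_(k < n) `|Y k w - Y' k w| < delta ->
        `|empirical_CE alpha (fun k => Y k w) -
          empirical_CE alpha (fun k => Y' k w)| < eps.

(* Main.v *)
Require Import Defs.
From mathcomp Require Import all_boot all_order all_algebra.
From mathcomp Require Import all_classical all_reals all_analysis.
From mathcomp Require Import lra.
Import Order.TTheory GRing.Theory Num.Theory.
Import numFieldNormedType.Exports.
Local Open Scope classical_set_scope.
Local Open Scope ring_scope.

(** The entropy is Lipschitz in the sample for the l^1 distance, with a constant
    independent of n. The weights u (- ln u)^alpha are bounded on ]0, 1], so
    |CE(x) - CE(y)| is at most a constant times the l^1 distance of the sorted
    samples. Sorting is an l^1 contraction (Crandall-Tartar): it is monotone and
    preserves sums, hence
    sum |x_(k) - y_(k)| <= sum (max(x, y)_(k) - min(x, y)_(k)) = sum |x_k - y_k|. *)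

Lemma sum_order_stat {R : realType} (n : nat) (x : 'I_n -> R) :
  \sum_(1 <= k < n.+1) order_stat x k = \sum_(i < n) x i.
Proof.
have sz : size (sort <=%R [seq x i | i : 'I_n]) = n.
  by rewrite size_sort size_map size_enum_ord.
rewrite big_add1 /= /order_stat /= -{1}sz.
rewrite -(big_nth 0 xpredT id) (perm_big [seq x i | i : 'I_n]) /=; last first.
  by rewrite perm_sort.
by rewrite big_map big_enum.
Qed.

(** By counting: if t, the order statistic of [y], were strictly below that of [x], then fewer
    entries of [x] than of [y] would be at most t, whereas [y i <= t] forces [x i <= t]. *)
Lemma le_order_stat {R : realType} (n : nat) (x y : 'I_n -> R) (k : nat) :
  (forall i, x i <= y i) -> (0 < k <= n)%N -> order_stat x k <= order_stat y k.
Proof.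
case: k => // k lexy /= ltkn; rewrite /order_stat /=.
set sx := sort _ [seq x i | i : 'I_n]; set sy := sort _ [seq y i | i : 'I_n].
have szx : size sx = n by rewrite size_sort size_map size_enum_ord.
have szy : size sy = n by rewrite size_sort size_map size_enum_ord.
have sox : sorted <=%R sx by apply: sort_sorted; exact: le_total.
have soy : sorted <=%R sy by apply: sort_sorted; exact: le_total.
set t := nth 0 sy k; rewrite leNgt; apply/negP => ltt.
pose p := fun z : R => z <= t.
have cxy : (count p sy <= count p sx)%N.
  rewrite !(permP (permEl (perm_sort _ _))) !count_map.
  by apply: sub_count => i /=; apply: le_trans.
(* Positions now start at 0: entries 0 to [k] of [sy] are at most [t], while those of [sx] from [k]
   on exceed it. *)
have cy : (k < count p sy)%N.
  rewrite -(cat_take_drop k.+1 sy) count_cat.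
  have -> : count p (take k.+1 sy) = k.+1.
    rewrite -[RHS](@size_takel k.+1 _ sy) ?szy //; apply/eqP.
    rewrite -all_count; apply/(all_nthP 0) => i; rewrite size_takel ?szy// => ltik.
    rewrite nth_take // /p /t; apply: sorted_leq_nth => //;
      rewrite ?inE ?szy //; first exact: le_trans.
    exact: leq_trans ltik ltkn.
  by rewrite leq_addr.
have cx : (count p sx <= k)%N.
  rewrite -(cat_take_drop k sx) count_cat.
  have -> : count p (drop k sx) = 0%N.
    apply/eqP; rewrite -leqn0 leqNgt -has_count; apply/(has_nthP 0) => -[i].
    rewrite size_drop szx nth_drop => ltik; rewrite /p leNgt => /negP; apply.
    apply: lt_le_trans ltt _; apply: sorted_leq_nth => //;
      rewrite ?inE ?szx ?leq_addr //; first exact: le_trans.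
    by rewrite -ltn_subRL.
  rewrite addn0; apply: leq_trans (count_size _ _) _.
  by rewrite size_takel // szx ltnW.
by have := leq_trans cy (leq_trans cxy cx); rewrite ltnn.
Qed.

Lemma order_stat_contraction {R : realType} (n : nat) (x y : 'I_n -> R) :
  \sum_(1 <= k < n.+1) `|order_stat x k - order_stat y k| <=
  \sum_(i < n) `|x i - y i|.
Proof.
pose u i := Num.max (x i) (y i); pose l i := Num.min (x i) (y i).
have -> : \sum_(i < n) `|x i - y i| =
    \sum_(1 <= k < n.+1) (order_stat u k - order_stat l k).
  rewrite sumrB !sum_order_stat -sumrB; apply: eq_bigr => i _.
  by rewrite /u /l; case: (leP (x i) (y i)) => h;
    [rewrite ler0_norm; lra | rewrite gtr0_norm; lra].
rewrite big_nat_cond [leRHS]big_nat_cond; apply: ler_sum => k /andP[kn _].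
have xu : order_stat x k <= order_stat u k.
  by apply: le_order_stat => // i; rewrite /u le_max lexx.
have yu : order_stat y k <= order_stat u k.
  by apply: le_order_stat => // i; rewrite /u le_max lexx orbT.
have lx : order_stat l k <= order_stat x k.
  by apply: le_order_stat => // i; rewrite /l ge_min lexx.
have ly : order_stat l k <= order_stat y k.
  by apply: le_order_stat => // i; rewrite /l ge_min lexx orbT.
(* Both order statistics lie between those of [l] and [u], so their distance is at most the length
   of that interval. *)
by rewrite ler_norml; apply/andP; split; lra.
Qed.

(** With L = - ln u the weight is L^alpha e^(-L). Raising L <= alpha e^(L/alpha), which follows from
    1 + z <= e^z at z = L/alpha, to the power alpha cancels the exponential. *)
Lemma entropy_weight_bound {R : realType} (alpha u : R) :
  0 < alpha -> 0 < u -> u <= 1 -> u * (- ln u) `^ alpha <= alpha `^ alpha.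
Proof.
move=> a0 u0 u1; set L := - ln u.
have L0 : 0 <= L by rewrite /L oppr_ge0 ln_le0.
have uE : u = expR (- L) by rewrite /L opprK lnK.
have Lle : L <= alpha * expR (L / alpha).
  have := expR_ge1Dx (L / alpha); rewrite -(ler_pM2l a0) mulrDr mulrCA divff ?gt_eqF//.
  lra.
have : L `^ alpha <= alpha `^ alpha * expR L.
  apply: (le_trans (ge0_ler_powR (ltW a0) _ _ Lle)); rewrite ?nnegrE//.
    by rewrite mulr_ge0 ?expR_ge0// ltW.
  by rewrite powRM ?expR_ge0 ?(ltW a0)// -expRM divfK ?gt_eqF.
by rewrite -(ler_pM2l u0) => /le_trans; apply; rewrite uE mulrCA -expRD addNr expR0 mulr1.
Qed.

(** The factor 2 arises because each order statistic enters two consecutive gaps. The norm around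
    the Gamma factor spares a discussion of its sign. *)
Lemma empirical_CE_lipschitz {R : realType} (alpha : R) (n : nat)
    (x y : 'I_n -> R) : 0 < alpha ->
  `|empirical_CE alpha x - empirical_CE alpha y| <=
  `|(Gamma (alpha + 1))^-1| * (2 * alpha `^ alpha) * \sum_(i < n) `|x i - y i|.
Proof.
move=> a0; rewrite /empirical_CE -mulrBr normrM -mulrA ler_wpM2l // -sumrB.
set S := \sum_(i < n) _; set D := fun k => `|order_stat x k - order_stat y k|.
have DS : \sum_(1 <= k < n.+1) D k <= S by exact: order_stat_contraction.
have D0 k : 0 <= D k by exact: normr_ge0.
(* This sum omits only the last term of [DS], the shifted one in [D2] only the first; for n = 0
   there is no term to split off. *)
have D1 : \sum_(1 <= k < n) D k <= S.
  apply: le_trans DS; case: n {x y S} D D0 => [|n] D D0; first by rewrite !big_geq.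
  by rewrite [leRHS]big_nat_recr //= lerDl.
have D2 : \sum_(1 <= k < n) D k.+1 <= S.
  apply: le_trans DS; rewrite [leRHS]big_add1 /=.
  case: n {x y S D1} D D0 => [|n] D D0; first by rewrite !big_geq.
  by rewrite [leRHS]big_ltn // lerDr.
apply: (@le_trans _ _ (\sum_(1 <= k < n) alpha `^ alpha * (D k.+1 + D k))).
  apply: (le_trans (ler_norm_sum _ _ _)).
  rewrite big_nat_cond [leRHS]big_nat_cond; apply: ler_sum => k /andP[/andP[k1 kn] _].
  rewrite -!mulrA -mulrBl normrM mulrC.
  have n0 : 0 < n%:R :> R by rewrite ltr0n (leq_ltn_trans _ kn).
  have k0 : 0 < k%:R :> R by rewrite ltr0n.
  apply: ler_pM => //.
    rewrite mulrA ger0_norm; last by rewrite mulr_ge0 ?powR_ge0 // divr_ge0 // ltW.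
    apply: entropy_weight_bound => //; first exact: divr_gt0.
    by rewrite ler_pdivrMr // mul1r ler_nat ltnW.
  (* The difference of two gaps regroups as the deviation at k+1 minus the deviation at k. *)
  rewrite /D; apply: le_trans (ler_normB _ _).
  by rewrite le_eqVlt; apply/orP; left; apply/eqP; congr `|_|; lra.
rewrite -mulr_sumr big_split /= [2 * _]mulrC -mulrA ler_wpM2l ?powR_ge0 //.
lra.
Qed.

Theorem theorem5p1 (R : realType) (alpha : R) (halpha : 0 < alpha)
    (d : measure_display) (T : measurableType d) (P : probability T R)
    (X : {RV P >-> R})
    (habscont : distribution P X `<< @lebesgue_measure R)
    (hnonneg : {ae P, forall w, 0 <= X w})
    (hfinite : exists a b : R, distribution P X `[a, b] = 1%E) :
  empirical_CE_stable alpha X.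
Proof.
move=> eps eps0.
set C := `|(Gamma (alpha + 1))^-1| * (2 * alpha `^ alpha).
have C0 : 0 <= C by rewrite !mulr_ge0 ?powR_ge0.
have C1 : 0 < C + 1 by lra.
(* Adding 1 keeps the divisor positive, [C] being only known to be nonnegative. This delta depends
   on [alpha] and [eps] alone, hence is uniform in n and in the realization. *)
exists (eps / (C + 1)); first exact: divr_gt0.
move=> n d' Omega Q Y _ Y' w; rewrite ltr_pdivlMr // => hS.
apply: le_lt_trans (empirical_CE_lipschitz _ _ _ _ halpha) _.
apply: le_lt_trans hS; rewrite -/C mulrC ler_wpM2l ?sumr_ge0 //; lra.
Qed.
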